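(* There exist a lattice $L$ (of some rank $n$), a Minkowski basis $v_1, \dots, v_n$ of $L$ and a Korkin-Zolotarev basis $u_1, \dots, u_n$ of $L$ such that $$\|v_n\| > \max\left\{ \|u_1\|, \dots, \|u_n\| \right\} = \overline{\lambda_n}(L).$$
   Context: A lattice is a discrete subgroup $L$ of some $\mathbb{R}^m$; its rank $n$ is the dimension of $\mathrm{span}_{\mathbb{R}}(L)$. $\|\cdot\|$ is the Euclidean norm. A basis of $L$ is a linearly independent sequence $b_1, \dots, b_n \in L$ with $\mathrm{span}_{\mathbb{Z}}(b_1, \dots, b_n) = L$. A sequence $b_1, \dots, b_i \in L$ is called primitive if it can be completed to a basis $b_1, \dots, b_n$ of $L$. $\overline{\lambda_i}(L)$ denotes the smallest real number such that there exists a primitive sequence $b_1, \dots, b_i \in L$ all of whose vectors have length at most $\overline{\lambda_i}(L)$. A basis $b_1, \dots, b_n$ of $L$ is a Minkowski basis if, for each $i$, $b_i$ is a vector of smallest length among all vectors $b \in L$ such that $b_1, \dots, b_{i-1}, b$ is primitive. A basis $b_1, \dots, b_n$ of $L$ is a Korkin-Zolotarev basis if, for each $i$, $b_i$ is a vector of smallest length among those vectors that minimize $\|\pi(b)\|$ over all $b \in L$ with $b \notin \mathrm{span}_{\mathbb{R}}(b_1, \dots, b_{i-1})$, where $\pi$ is the orthogonal projection onto $\mathrm{span}_{\mathbb{R}}(b_1, \dots, b_{i-1})^{\perp}$. In both definitions ties are resolved arbitrarily, so these bases need not be unique. *)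

(* Defs.v *)
From HB Require Import structures.
From mathcomp Require Import all_boot all_order all_algebra.
From mathcomp Require Import all_classical all_reals.
From mathcomp Require Import topology normedtype.

Set Implicit Arguments.
Unset Strict Implicit.
Unset Printing Implicit Defensive.

Import Order.TTheory GRing.Theory Num.Theory.
Import numFieldNormedType.Exports.

Local Open Scope classical_set_scope.
Local Open Scope ring_scope.

Section EuclideanSpace.
Variables (R : realType) (m : nat).
Implicit Types (u v : 'rV[R]_m) (U : {vspace 'rV[R]_m}).

Definition dotp u v : R := \sum_(j < m) u 0 j * v 0 j.

Lemma dotpC u v : dotp u v = dotp v u.
Proof. by apply: eq_bigr => j _; rewrite mulrC. Qed.

Fact dotp_linearr u : linear_for *%R (dotp u).
Proof.
move=> a v w; rewrite /dotp mulr_sumr -big_split /=.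
by apply: eq_bigr => j _; rewrite !mxE mulrDr mulrCA.
Qed.

Fact dotp_linearl v : linear_for *%R (dotp ^~ v).
Proof. by move=> a u w; rewrite /= !(dotpC _ v) dotp_linearr. Qed.

HB.instance Definition _ :=
  bilinear_isBilinear.Build R 'rV[R]_m 'rV[R]_m R *%R (idfun \; *%R) dotp
    (dotp_linearl, dotp_linearr).

Fact dotp_hermitian u v : dotp u v = (-1) ^+ false * idfun (dotp v u).
Proof. by rewrite expr0 mul1r dotpC. Qed.

HB.instance Definition _ :=
  isHermitianSesquilinear.Build R 'rV[R]_m false idfun dotp dotp_hermitian.

(* The library norm `|v| on row vectors is the sup norm. *)
Definition enorm v : R := Num.sqrt (dotp v v).

(* The orthogonal projection onto the orthogonal complement of U; see
   perp_projP. *)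
Definition perp_proj U : 'End('rV[R]_m) := daddv_pi (orthov (@dotp) U) U.

Lemma dotpp_eq0 v : (dotp v v == 0) = (v == 0).
Proof.
apply/eqP/eqP => [v0|->]; last by rewrite linear0r.
apply/rowP => j; rewrite mxE; apply/eqP; rewrite -sqrf_eq0 expr2; apply/eqP.
by apply: (psumr_eq0P _ v0) => // i _; rewrite -expr2 sqr_ge0.
Qed.

Lemma capv_orthov U : (orthov (@dotp) U :&: U = 0)%VS.
Proof.
apply/eqP; rewrite -subv0; apply/subvP => v.
rewrite memv_cap memv0 => /andP[/mem_orthovP vU vinU].
by rewrite -dotpp_eq0 (vU v vinU).
Qed.

Lemma dim_orthov_span (s : seq 'rV[R]_m) :
  (m - size s <= \dim (orthov (@dotp) <<s>>))%N.
Proof.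
elim: s => [|u s IHs] /=.
  by rewrite span_nil orthov0 dimvf /dim /= mul1n subn0.
have -> : orthov (@dotp) <<u :: s>>
    = (orthov (@dotp) <<s>> :&: orthov (@dotp) <[u]>)%VS.
  apply/eqP; rewrite eqEsubv span_cons subv_cap !orthovD.
  have := subvv (orthov (@dotp) (<[u]> + <<s>>)).
  by rewrite orthovD => /andP[-> ->]; rewrite capvSl capvSr.
by apply: leq_trans (leq_dim_orthov1 _ _ _); rewrite subnS -!subn1 leq_sub2r.
Qed.

Lemma addv_orthov U : (orthov (@dotp) U + U = fullv)%VS.
Proof.
apply/eqP; rewrite eqEdim subvf /= dimv_disjoint_sum ?capv_orthov//.
have := dim_orthov_span (vbasis U).
by rewrite size_tuple (span_basis (vbasisP U)) dimvf /dim /= mul1n leq_subLR addnC.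
Qed.

Lemma perp_projP U v :
  perp_proj U v \in orthov (@dotp) U /\ v - perp_proj U v \in U.
Proof.
have vF : v \in (orthov (@dotp) U + U)%VS by rewrite addv_orthov memvf.
have vE := daddv_pi_add (capv_orthov U) vF.
split; first exact: memv_pi.
by rewrite -[X in X - _]vE /perp_proj addrC addKr memv_pi.
Qed.

End EuclideanSpace.

Section Lattices.
Variables (R : realType) (m : nat).
Local Notation V := 'rV[R]_m.
Implicit Types (L A : set V) (b s : seq V).

Definition is_lattice L :=
  [/\ L 0, forall x y, L x -> L y -> L (x - y) & L `<=` isolated L].

(* span_R(L) is the smallest subspace that contains L. *)
Definition real_span L (U : {vspace V}) :=
  (forall x, L x -> x \in U) /\
  forall W : {vspace V}, (forall x, L x -> x \in W) -> (U <= W)%VS.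

Definition lattice_rank L (n : nat) := exists2 U, real_span L U & \dim U = n.

Definition int_span b : set V :=
  [set x | exists z : 'I_(size b) -> int,
    x = \sum_(i < size b) b`_i *~ z i].

Definition is_basis L b :=
  [/\ lattice_rank L (size b), free b & int_span b = L].

Definition primitive L s := exists t, is_basis L (s ++ t).

(* The successive minimum of L for primitive sequences of length i exists
   and equals r. *)
Definition is_primitive_minimum L (i : nat) (r : R) :=
  let bounds := [set r' | exists s, [/\ primitive L s, size s = i &
                            forall x, x \in s -> enorm x <= r']] in
  bounds r /\ lbound bounds r.

Definition shortest_in A (x : V) :=
  A x /\ forall y, A y -> enorm x <= enorm y.

Definition minkowski_basis L b :=
  is_basis L b /\
  forall i, (i < size b)%N ->
    shortest_in [set x | L x /\ primitive L (rcons (take i b) x)] b`_i.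

Definition kz_candidates L (U : {vspace V}) : set V :=
  [set x | [/\ L x, x \notin U &
    forall y, L y -> y \notin U ->
      enorm (perp_proj U x) <= enorm (perp_proj U y)]].

Definition korkin_zolotarev_basis L b :=
  is_basis L b /\
  forall i, (i < size b)%N ->
    shortest_in (kz_candidates L <<take i b>>%VS) b`_i.

Definition max_enorm s : R := \big[Num.max/0]_(x <- s) enorm x.

End Lattices.

(* Main.v *)
Require Import Defs.
From HB Require Import structures.
From mathcomp Require Import all_boot all_order all_algebra.
From mathcomp Require Import all_classical all_reals.
From mathcomp Require Import topology normedtype.
From mathcomp Require Import zify ring lra.

Set Implicit Arguments.
Unset Strict Implicit.
Unset Printing Implicit Defensive.

Import Order.TTheory GRing.Theory Num.Theory.
Import numFieldNormedType.Exports.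

Local Open Scope classical_set_scope.
Local Open Scope ring_scope.

(* Put c = (3, 3, 3, 1, -2, ..., -2) in Z^12 and let L consist of the integer
   vectors z with z = z_3 c mod 6 (coordinates counted from 0).
   A residue check on z_3 mod 6 shows that nonzero vectors of L have norm at
   least 6, and that those with z_3 coprime to 6 have squared norm at least 60.
   The eleven vectors 6 e_j (j <> 3) are shortest and form a primitive sequence;
   any vector completing it has z_3 = +-1, so the greedy Minkowski basis ends
   with a vector of length sqrt 60.
   On the other hand x = (3, 3, 3, 3, 0, ..., 0) and y = (0, 0, 0, 2, ..., 2) are
   shortest too, c = x - y, and x, 6 e_0, 6 e_1, 6 e_2, y, 6 e_4, ..., 6 e_10 is a
   Korkin-Zolotarev basis made of shortest vectors.  To see that it is one, note
   that projecting away the first i of them kills the coordinates below i - 1 and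
   centers a block of m further coordinates.  On that block the entries of a
   lattice vector differ by multiples of 6 (or else the remaining coordinates
   contribute at least 32), and a centered vector which is not constant and
   whose entries differ by multiples of 6 has squared norm at least
   36 (m - 1) / m, the value attained by 6 e_(i-1). *)

(** * Residues modulo 6 and lower bounds for squared norms of integer vectors *)

Section IntegerCoordinates.
Implicit Type f : nat -> int.

(* Entry j of (a, a, a, b, c, c, ...). *)
Definition tri (j : nat) (a b c : int) : int :=
  if (j < 3)%N then a else if (j < 4)%N then b else c.

(** Indexed by the function [tri j] and not by a value, so that one case analysis resolves all
    occurrences of [tri j], whatever their arguments. *)
Variant tri_spec j : (int -> int -> int -> int) -> Prop :=
  | TriLow of (j < 3)%N : tri_spec j (fun a _ _ => a)
  | TriMid of j = 3%N : tri_spec j (fun _ b _ => b)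
  | TriHigh of (4 <= j)%N : tri_spec j (fun _ _ c => c).

Lemma triP j : tri_spec j (tri j).
Proof.
have [j3|[->|j4]] : (j < 3)%N \/ j = 3%N \/ (4 <= j)%N by lia.
- rewrite (_ : tri j = fun a _ _ => a); first exact: TriLow.
  by apply/funext => a; apply/funext => b; apply/funext => c; rewrite /tri j3.
- exact: TriMid.
- rewrite (_ : tri j = fun _ _ c => c); first exact: TriHigh.
  apply/funext => a; apply/funext => b; apply/funext => c.
  by rewrite /tri; do 2 (case: ifP => [?|_]; first by lia).
Qed.

(* Vectors of Z^12 are encoded as functions on nat; the values at j >= 12 are
   constrained here but read nowhere else. *)
Definition in_lat f := forall j, (6 %| f j - tri j 3 1 (-2) * f 3%N)%Z.

Definition sqn f : int := \sum_(j < 12) f j ^+ 2.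

Lemma ler_sqr_abs (a z : int) :
  0 <= a -> (z <= - a) || (a <= z) -> a ^+ 2 <= z ^+ 2.
Proof. by move=> a0 /orP[?|?]; nia. Qed.

Lemma sqn_ge (a b c : int) f :
    (forall j, let t := tri j a b c in
      (0 <= t) && ((f j <= - t) || (t <= f j))) ->
  a ^+ 2 *+ 3 + b ^+ 2 + c ^+ 2 *+ 8 <= sqn f.
Proof.
move=> bf; have -> : a ^+ 2 *+ 3 + b ^+ 2 + c ^+ 2 *+ 8
    = \sum_(j < 12) tri j a b c ^+ 2.
  by rewrite !big_ord_recl big_ord0 /= /tri /=; ring.
by apply: ler_sum => j _; case/andP: (bf j); apply: ler_sqr_abs.
Qed.

(** The three low entries are 3 mod 6, [f 3] is nonzero, and the eight high entries are even and
    prime to 3: 3 * 9 + 1 + 8 * 4 = 60. *)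
Lemma sqn_ge60 f : in_lat f -> ~~ (2 %| f 3%N)%Z -> ~~ (3 %| f 3%N)%Z ->
  60 <= sqn f.
Proof.
move=> fL f2 f3; apply: (sqn_ge (a := 3) (b := 1) (c := 2)) => j /=.
by have := fL j; case: (triP j) => [_|->|_]; lia.
Qed.

Lemma sqn_ge36 f : in_lat f -> (exists j : 'I_12, f j != 0) -> 36 <= sqn f.
Proof.
move=> fL [j0 fj0].
(* If 6 divides [f 3], all entries are multiples of 6. If only 2 does, coordinates 3 to 11 give 4 +
   8 * 4 = 36; if only 3 does, coordinates 0 to 3 give 4 * 9 = 36. *)
have [f2|f2] := boolP (2 %| f 3%N)%Z; have [f3|f3] := boolP (3 %| f 3%N)%Z.
- have f6 : (6 %| f j0)%Z by have := fL j0; case: (triP j0); lia.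
  rewrite /sqn (bigD1 j0)//= -[36]addr0 lerD//; last first.
    by apply: sumr_ge0 => j _; apply: sqr_ge0.
  by rewrite (_ : 36 = 6 ^+ 2)//; apply: ler_sqr_abs => //; lia.
- apply: (sqn_ge (a := 0) (b := 2) (c := 2)) => j /=.
  by have := fL j; case: (triP j) => [_|->|_]; lia.
- apply: (sqn_ge (a := 3) (b := 3) (c := 0)) => j /=.
  by have := fL j; case: (triP j) => [_|->|_]; lia.
- by have := sqn_ge60 fL f2 f3; lia.
Qed.

End IntegerCoordinates.

(** * Integer spans, and coordinate conditions preserved by real spans *)

Section IntSpan.
Variables (R : realType) (m : nat).
Implicit Types (b : seq 'rV[R]_m) (x y : 'rV[R]_m) (A : set 'rV[R]_m).

Definition subgroup A := A 0 /\ forall x y, A x -> A y -> A (x - y).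

Lemma subgroupD A x y : subgroup A -> A x -> A y -> A (x + y).
Proof.
move=> [A0 AB] Ax Ay; rewrite -[y]opprK; apply: (AB) => //.
by rewrite -sub0r; apply: AB.
Qed.

Lemma subgroup_mulrz A x z : subgroup A -> A x -> A (x *~ z).
Proof.
move=> sA Ax; have pos n : A (x *+ n).
  elim: n => [|n IHn]; first by case: sA.
  by rewrite mulrS; apply: subgroupD.
case: z => n; first exact: pos.
by rewrite NegzE mulrNz -sub0r; apply: (sA.2) (pos _); apply: sA.1.
Qed.

Lemma subgroup_sum A (I : finType) (P : pred I) (F : I -> 'rV[R]_m) :
  subgroup A -> (forall i, P i -> A (F i)) -> A (\sum_(i | P i) F i).
Proof.
move=> sA AF; elim/big_ind: _ => //; first by case: sA.
by move=> x y; apply: subgroupD.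
Qed.

Lemma int_span_subgroup b : subgroup (int_span b).
Proof.
split; first by exists (fun=> 0); rewrite big1.
move=> _ _ [z ->] [t ->]; exists (fun i => z i - t i).
by rewrite -sumrB; apply: eq_bigr => i _; rewrite mulrzBr.
Qed.

Lemma mem_int_span b x : x \in b -> int_span b x.
Proof.
move=> /(nthP 0)[i ib <-]; exists (fun j => (val j == i)%:Z).
rewrite (bigD1 (Ordinal ib))//= eqxx big1 ?addr0// => j /eqP ji.
by rewrite (introF eqP)// => ?; apply: ji; apply: val_inj.
Qed.

Lemma int_span_min A b :
  subgroup A -> (forall x, x \in b -> A x) -> int_span b `<=` A.
Proof.
move=> sA Ab _ [z ->]; apply: subgroup_sum => // i _.
by apply: subgroup_mulrz => //; apply/Ab/mem_nth.
Qed.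

Lemma lattice_rank_unique (L : set 'rV[R]_m) n p :
  lattice_rank L n -> lattice_rank L p -> n = p.
Proof.
move=> [U [LU minU] <-] [W [LW minW] <-]; congr (\dim _).
by apply/eqP; rewrite eqEsubv minU// minW.
Qed.

Lemma is_basis_mem (L : set 'rV[R]_m) b x :
  is_basis L b -> x \in b -> L x /\ x != 0.
Proof.
move=> [_ bfree <-] xb; split; first exact: mem_int_span.
exact: free_not0 bfree xb.
Qed.

Lemma span_coord_eq b (j k : 'I_m) x :
  (forall y, y \in b -> y 0 j = y 0 k) -> x \in <<b>>%VS -> x 0 j = x 0 k.
Proof.
move=> bjk /(coord_span (X := in_tuple b)) ->; rewrite !summxE.
by apply: eq_bigr => i _; rewrite !mxE bjk// mem_nth.
Qed.

Lemma span_coord_eq0 b (j : 'I_m) x :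
  (forall y, y \in b -> y 0 j = 0) -> x \in <<b>>%VS -> x 0 j = 0.
Proof.
move=> bj /(coord_span (X := in_tuple b)) ->; rewrite summxE.
by rewrite big1// => i _; rewrite !mxE bj ?mulr0// mem_nth.
Qed.

End IntSpan.

(** * The lattice, its discreteness and its minimum *)

Section Lattice.
Variable R : realType.
Implicit Types f g : nat -> int.

Definition ivec f : 'rV[R]_12 := \row_(j < 12) (f j)%:~R.

Definition lat : set 'rV[R]_12 := [set x | exists2 f, in_lat f & x = ivec f].

Lemma ivec_lat f : in_lat f -> lat (ivec f).
Proof. by exists f. Qed.

Lemma dotp_ivec f : dotp (ivec f) (ivec f) = (sqn f)%:~R.
Proof.
rewrite /dotp /sqn rmorph_sum /=; apply: eq_bigr => j _.
by rewrite !mxE rmorphXn expr2.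
Qed.

Lemma enorm_ivec f : enorm (ivec f) = Num.sqrt (sqn f)%:~R.
Proof. by rewrite /enorm dotp_ivec. Qed.

Lemma lat_subgroup : subgroup lat.
Proof.
split.
  by exists (fun=> 0) => [j|]; [lia|apply/rowP => j; rewrite !mxE].
move=> _ _ [f fL ->] [g gL ->]; exists (fun j => f j - g j) => [j|].
  by have := fL j; have := gL j; case: (triP j); lia.
by apply/rowP => j; rewrite !mxE rmorphB.
Qed.

(** Distinct integer vectors are at sup-norm distance at least 1. *)
Lemma lat_isolated : lat `<=` isolated lat.
Proof.
move=> x Lx; split; first exact: mem_set.
exists (ball x 1); first exact: nbhsx_ballx.
apply/seteqP; split=> [y [bxy [g gL yE]]|_ ->]; last first.
  by split=> //; apply: ballxx.
move: Lx bxy => [f fL xE] bxy; apply/rowP => j; case: bxy => _ /(_ 0 j).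
rewrite xE yE /ball /= !mxE -intrB -intr_norm (ltrz1 R) => fg.
by congr intmul; lia.
Qed.

Lemma ivec_neq0 f : ivec f != 0 -> exists j : 'I_12, f j != 0.
Proof.
move=> f0; apply/existsP; apply: contraR f0 => /existsPn f0.
apply/eqP/rowP => j.
by rewrite !mxE; have := f0 j; rewrite negbK => /eqP ->.
Qed.

Lemma lat_enorm_ge6 x : lat x -> x != 0 -> 6 <= enorm x.
Proof.
move=> [f fL ->] /ivec_neq0 f0.
rewrite enorm_ivec -[6]ger0_norm// -sqrtr_sqr ler_wsqrtr//.
by rewrite -natrX -[_%:R]mulrz_nat ler_int; apply: sqn_ge36.
Qed.
End Lattice.

Arguments lat {R}.

(** * The two bases and the proof that each generates the lattice *)

Section Bases.
Variable R : realType.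
Implicit Types (f : nat -> int) (s : seq 'rV[R]_12).

Lemma ivec_mulrz f z : ivec R f *~ z = ivec R (fun j => f j * z).
Proof. by apply/rowP => j; rewrite -scaler_int !mxE intrM mulrC. Qed.

Lemma ivecD f g : ivec R f + ivec R g = ivec R (fun j => f j + g j).
Proof. by apply/rowP => j; rewrite !mxE intrD. Qed.

Lemma ivec_sum (P : pred 'I_12) (F : nat -> nat -> int) :
  \sum_(j < 12 | P j) ivec R (F j)
    = ivec R (fun i => \sum_(j < 12 | P j) F j i).
Proof.
apply/rowP => i; rewrite summxE mxE rmorph_sum.
by apply: eq_bigr => j _; rewrite mxE.
Qed.

Lemma eq_ivec f g : (forall j, (j < 12)%N -> f j = g j) -> ivec R f = ivec R g.
Proof. by move=> fg; apply/rowP => j; rewrite !mxE fg. Qed.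

Definition six j : 'rV[R]_12 := ivec R (fun i => if i == j then 6 else 0).
Definition tvec a b c : 'rV[R]_12 := ivec R (fun j => tri j a b c).

Lemma lat_six j : lat (six j).
Proof.
by apply: ivec_lat => i; case: (triP i) => [|->|]; repeat case: eqP; lia.
Qed.

(** Only the support of [a] matters, so this applies before every 6 e_j is known to lie in the
    span. *)
Lemma int_span_ivec6 s (a : nat -> int) :
    (forall j, (j < 12)%N -> a j != 0 -> int_span s (six j)) ->
  int_span s (ivec R (fun j => 6 * a j)).
Proof.
move=> bsix; have sG := int_span_subgroup s.
rewrite (_ : ivec R _ = \sum_(j < 12 | a j != 0) six j *~ a j).
  by apply: subgroup_sum => // j aj; apply: subgroup_mulrz => //; apply: bsix.
under [RHS]eq_bigr do rewrite ivec_mulrz.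
rewrite (ivec_sum (fun j => a j != 0)
  (fun j i => (if i == j then 6 else 0) * a j)).
apply: eq_ivec => i i12.
rewrite big_mkcond (bigD1 (Ordinal i12))//= big1 ?addr0 => [|j /eqP ji].
  by rewrite eqxx; case: eqVneq => [->|].
rewrite (_ : (i == j :> nat) = false) ?mul0r ?if_same//.
by apply/eqP => ij; apply: ji; apply: val_inj.
Qed.

(** Subtracting [f 3] times c from a lattice vector leaves multiples of 6, with 0 at coordinate 3
    because c has entry 1 there. *)
Lemma lat_sub_int_span s : int_span s (tvec 3 1 (-2)) ->
  (forall j, (j < 12)%N -> j != 3%N -> int_span s (six j)) ->
  lat `<=` int_span s.
Proof.
move=> sc ssix _ [f fL ->]; have sG := int_span_subgroup s.
pose a j := ((f j - tri j 3 1 (-2) * f 3%N) %/ 6)%Z.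
rewrite (_ : ivec R f = tvec 3 1 (-2) *~ f 3%N + ivec R (fun j => 6 * a j)).
  apply: subgroupD => //; first exact: subgroup_mulrz.
  apply: int_span_ivec6 => j j12 aj; apply: ssix => //.
  by apply: contraNneq aj => ->; rewrite /a /tri /= mul1r subrr.
rewrite ivec_mulrz ivecD; apply: eq_ivec => j _.
by rewrite mulrC [6 * _]mulrC divzK//; first by ring.
Qed.

(** The lattice contains every 6 e_j, hence spans the whole space, and 12 vectors spanning a space
    of dimension 12 are free. *)
Lemma is_basis_lat s : size s = 12%N -> int_span s = lat -> is_basis (lat) s.
Proof.
move=> s12 sL; have sfull : (<<s>> = fullv)%VS.
  apply/eqP; rewrite eqEsubv subvf; apply/subvP => x _.
  rewrite (row_sum_delta x); apply: memv_suml => j _; apply: memvZ.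
  have [z zE] : int_span s (six j) by rewrite sL; apply: lat_six.
  rewrite (_ : delta_mx _ _ = (6^-1 : R) *: six j); last first.
    apply/rowP => i; rewrite !mxE /= -val_eqE /=.
    by case: eqP => _ /=; rewrite ?mulr0// (rmorph_nat _ 6) mulVf// pnatr_eq0.
  rewrite zE; apply/memvZ/memv_suml => i _.
  by rewrite -scaler_int; apply/memvZ/memv_span/mem_nth.
have dimR : \dim {: 'rV[R]_12} = 12%N by rewrite dimvf /dim /= mul1n.
split=> //; last by rewrite /free sfull dimR s12.
exists fullv => //; last by rewrite dimR.
split=> [x _|W LW]; first exact: memvf.
rewrite -sfull; apply/span_subvP => x xs.
by apply: LW; rewrite -sL; apply: mem_int_span.
Qed.

(** [bump 3] skips the index 3. *)
Definition mink_vec k := if k == 11%N then tvec 3 1 (-2) else six (bump 3 k).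
Definition mink := mkseq mink_vec 12.

(** The shift by one makes room for x in front; y stands in the place of 6 e_3, and 6 e_11 is
    absent. *)
Definition kz_vec k :=
  if k == 0%N then tvec 3 3 0 else if k == 4%N then tvec 0 2 2 else six k.-1.
Definition kz := mkseq kz_vec 12.

Lemma mem_mink k : (k < 12)%N -> int_span mink (mink_vec k).
Proof. by move=> k12; apply/mem_int_span/map_f; rewrite mem_iota. Qed.

Lemma mem_kz k : (k < 12)%N -> int_span kz (kz_vec k).
Proof. by move=> k12; apply/mem_int_span/map_f; rewrite mem_iota. Qed.

Lemma int_span_mink : int_span mink = lat.
Proof.
apply/seteqP; split.
  apply: int_span_min; first exact: lat_subgroup.
  move=> _ /mapP[k _ ->]; rewrite /mink_vec; case: ifP => _; last exact: lat_six.
  by apply: ivec_lat => j; case: (triP j); rewrite /tri /=; lia.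
apply: lat_sub_int_span => [|j j12 j3]; first exact: (@mem_mink 11).
have k11 : (unbump 3 j < 11)%N by rewrite /unbump; case: ltnP => /=; lia.
have := mem_mink (ltnW k11); rewrite /mink_vec (ltn_eqF k11).
by rewrite unbumpK// inE.
Qed.

Lemma int_span_kz : int_span kz = lat.
Proof.
apply/seteqP; split.
  apply: int_span_min; first exact: lat_subgroup.
  move=> _ /mapP[k _ ->]; rewrite /kz_vec.
  case: ifP => _; last case: ifP => _; last exact: lat_six.
    by apply: ivec_lat => j; case: (triP j); rewrite /tri /=; lia.
  by apply: ivec_lat => j; case: (triP j); rewrite /tri /=; lia.
have sG := int_span_subgroup kz.
have kX : int_span kz (tvec 3 3 0) := @mem_kz 0 isT.
have kY : int_span kz (tvec 0 2 2) := @mem_kz 4 isT.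
have ksix j : (j < 11)%N -> j != 3%N -> int_span kz (six j).
  by move=> j11 j3; have := @mem_kz j.+1 j11; rewrite /kz_vec /= eqSS (negbTE j3).
apply: lat_sub_int_span => [|j j12 j3].
  rewrite (_ : tvec _ _ _ = tvec 3 3 0 + tvec 0 2 2 *~ (-1)).
    by apply: subgroupD => //; exact: subgroup_mulrz.
  by rewrite ivec_mulrz ivecD; apply: eq_ivec => j _; case: (triP j).
have [|j11] := ltnP j 11; first by move/ksix; apply.
(* The absent 6 e_11 is recovered from -2 x + 3 y = (-6, -6, -6, 0, 6, ..., 6) by cancelling the
   entries other than the last with available vectors 6 e_i. *)
pose a i : int := if i == 11%N then 0 else tri i 1 0 (-1).
rewrite (_ : six j =
    tvec 3 3 0 *~ (-2) + tvec 0 2 2 *~ 3 + ivec R (fun j => 6 * a j)).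
  apply: subgroupD => //; first by apply: subgroupD => //; exact: subgroup_mulrz.
  apply: int_span_ivec6 => i i12; rewrite /a.
  case: (eqVneq i 11%N) => // i11.
  by case: (triP i) => // i34 _; apply: ksix; lia.
rewrite !ivec_mulrz !ivecD; apply: eq_ivec => i i12.
by rewrite /a; case: (triP i) => [||]; repeat case: eqP; lia.
Qed.

End Bases.

(** * Lengths, the primitive minimum and the Minkowski property *)

Section Minkowski.
Variable R : realType.
Implicit Types x y : 'rV[R]_12.

Lemma mink_basis : is_basis lat (mink R).
Proof. by apply: is_basis_lat; [rewrite size_mkseq|exact: int_span_mink]. Qed.

Lemma kz_basis : is_basis lat (kz R).
Proof. by apply: is_basis_lat; [rewrite size_mkseq|exact: int_span_kz]. Qed.

Lemma enorm_six j : (j < 12)%N -> enorm (six R j) = 6.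
Proof.
move=> j12; rewrite enorm_ivec /sqn (bigD1 (Ordinal j12))//= eqxx big1 ?addr0.
  by rewrite rmorphXn /= sqrtr_sqr (rmorph_nat _ 6) normr_nat.
move=> i /eqP ij; case: eqP => // iE; case: ij; exact: val_inj.
Qed.

Lemma enorm_tvec a b c :
  enorm (tvec R a b c) = Num.sqrt (a ^+ 2 *+ 3 + b ^+ 2 + c ^+ 2 *+ 8)%:~R.
Proof.
rewrite enorm_ivec; congr (Num.sqrt (intmul _ _)).
by rewrite /sqn !big_ord_recl big_ord0 /tri /=; ring.
Qed.

Lemma sqrt36 : Num.sqrt 36%:~R = 6 :> R.
Proof. by rewrite (_ : 36%:~R = 6 ^+ 2) ?sqrtr_sqr ?normr_nat//; ring. Qed.

Lemma enorm_kz i : (i < 12)%N -> enorm (kz_vec R i) = 6.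
Proof.
move=> i12; rewrite /kz_vec.
do 2 (case: ifP => _; first by rewrite enorm_tvec sqrt36).
by rewrite enorm_six//; lia.
Qed.

Lemma max_enorm_kz : max_enorm (kz R) = 6.
Proof.
(* The iterated maximum starts from 0, so 6 is written as the maximum of 6 and 0. *)
rewrite /max_enorm -[RHS](max_l (ler0n R 6)) /kz /mkseq big_map.
rewrite (eq_big_seq (fun=> 6)) => [|i]; last by rewrite mem_iota; apply: enorm_kz.
by rewrite !big_cons big_nil !maxA !maxxx.
Qed.

Lemma kz_primitive_minimum : is_primitive_minimum lat 12 (max_enorm (kz R)).
Proof.
split=> [|r [s [[t bst] s12 sr]]].
  exists (kz R); split; [|by rewrite size_mkseq|].
    by exists [::]; rewrite cats0; apply: kz_basis.
  move=> x /mapP[i]; rewrite mem_iota => i12 ->.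
  by rewrite enorm_kz// max_enorm_kz.
case: s s12 bst sr => // x s _ bst sr; rewrite max_enorm_kz.
have xs : x \in x :: s by rewrite mem_head.
apply: le_trans (sr x xs); have [|Lx x0] := is_basis_mem bst (x := x).
  by rewrite mem_cat xs.
exact: lat_enorm_ge6.
Qed.

(** By rank, the sequence is already a basis. All its vectors but [y] vanish at coordinate 3, so
    that coordinate of [y] divides the entry 1 of c; it is 1 or -1, and [sqn_ge60] applies. *)
Lemma glue_shortest y :
  primitive lat (rcons (take 11 (mink R)) y) ->
  enorm (tvec R 3 1 (-2)) <= enorm y.
Proof.
move=> [t bt]; have t0 : t = [::].
  have [[rk _ _] [rk' _ _]] := (bt, mink_basis).
  have := lattice_rank_unique rk rk'.
  by rewrite size_cat size_rcons size_take size_mkseq /=; clear; case: t.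
move: bt; rewrite {}t0 cats0 => bt; have [_ _ spE] := bt.
have [f fL yE] : lat y.
  by case: (is_basis_mem bt (x := y)); rewrite ?mem_rcons ?mem_head.
pose A : set 'rV[R]_12 := [set x | exists z, x 0 (inord 3) = (f 3%N * z)%:~R].
have sA : subgroup A.
  split; first by exists 0; rewrite mxE mulr0.
  move=> x x' [z zE] [z' zE']; exists (z - z').
  by rewrite !mxE zE zE' mulrBr rmorphB.
have [z] : A (tvec R 3 1 (-2)).
  have cL : lat (tvec R 3 1 (-2)).
    by case: (is_basis_mem mink_basis (x := mink_vec R 11)); rewrite ?map_f ?mem_iota.
  rewrite -spE in cL; apply: int_span_min cL => // x.
  rewrite mem_rcons inE => /orP[/eqP ->|].
    by exists 1; rewrite yE mxE inordK// mulr1.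
  rewrite /mink /mkseq -map_take take_iota => /mapP[k]; rewrite mem_iota => k11 ->.
  exists 0; rewrite /mink_vec (ltn_eqF k11) mxE inordK//.
  by rewrite mulr0 (negbTE (neq_bump 3 k)).
rewrite mxE inordK// => /intr_inj f3z.
have f3 : f 3%N = 1 \/ f 3%N = -1.
  have : (f 3%N %| 1)%Z by apply/dvdzP; exists z; rewrite mulrC -f3z.
  by rewrite dvdz1; lia.
rewrite enorm_tvec yE enorm_ivec ler_wsqrtr// ler_int.
by apply: le_trans (sqn_ge60 fL _ _) => //; case: f3 => ->.
Qed.

Lemma mink_minkowski : minkowski_basis lat (mink R).
Proof.
split=> [|i]; first exact: mink_basis.
rewrite size_mkseq => i12; rewrite nth_mkseq//.
have mi : mink_vec R i \in mink R by rewrite map_f// mem_iota.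
have [Li _] := is_basis_mem mink_basis mi.
split=> [|y [Ly py]].
  split=> //; exists (drop i.+1 (mink R)).
  rewrite -[mink_vec R i](nth_mkseq 0 (mink_vec R) i12) -take_nth ?size_mkseq//.
  by rewrite cat_take_drop; apply: mink_basis.
have [i11|i11] := ltnP i 11; last first.
  have iE : i = 11%N by lia.
  by rewrite iE in py *; apply: glue_shortest.
rewrite /mink_vec (ltn_eqF i11) enorm_six; last by rewrite /bump; lia.
apply: lat_enorm_ge6 => //; case: py => t /is_basis_mem yP.
by case: (yP y) => //; rewrite mem_cat mem_rcons mem_head.
Qed.

End Minkowski.

(** * Sums of squares of centered families *)

Section CenteredBlock.
Variables (R : realFieldType) (I : finType) (S : {pred I}) (w : I -> R).
Hypothesis w_sum0 : \sum_(j in S) w j = 0.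

(** The cross terms vanish because [w] sums to 0 over [S]. *)
Lemma sum_sqr_diff :
  \sum_(i in S) \sum_(j in S) (w i - w j) ^+ 2
    = #|S|%:R * (\sum_(j in S) w j ^+ 2) *+ 2.
Proof.
pose q := \sum_(j in S) w j ^+ 2.
have row i : \sum_(j in S) (w i - w j) ^+ 2 = #|S|%:R * w i ^+ 2 + q.
  rewrite (eq_bigr (fun j => (w i ^+ 2 + w j ^+ 2) - 2 * w i * w j));
    last by move=> j _; ring.
  by rewrite sumrB big_split /= sumr_const -mulr_sumr w_sum0 mulr0 subr0 mulr_natl.
rewrite (eq_bigr _ (fun i _ => row i)) big_split /= -mulr_sumr sumr_const.
by rewrite mulr2n mulr_natl.
Qed.

(* The subset of S where w takes a fixed value has size a > 0 and its complement
   in S has size b > 0: this gives a b >= a + b - 1 pairs at distance >= 6. *)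
Lemma block_lower_bound :
    {in S &, forall i j, exists z : int, w i - w j = 6 * z%:~R} ->
    {in S, forall i, exists2 j, j \in S & w j != w i} ->
  forall i0, i0 \in S ->
  36 * (#|S|%:R - 1) <= #|S|%:R * \sum_(j in S) w j ^+ 2.
Proof.
move=> w6 wS i0 i0S.
pose a := #|[pred j in S | w j == w i0]|.
pose b := #|[pred j in S | w j != w i0]|.
have Sab : #|S| = (a + b)%N.
  rewrite -(cardID [pred j | w j == w i0] S).
  by congr (_ + _)%N; apply: eq_card => j; rewrite !inE andbC.
have a0 : (0 < a)%N by apply/card_gt0P; exists i0; rewrite inE i0S /=.
have b0 : (0 < b)%N.
  by have [j jS jw] := wS _ i0S; apply/card_gt0P; exists j; rewrite inE jS.
have far i j : i \in S -> j \in S -> w i != w j -> 36 <= (w i - w j) ^+ 2.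
  move=> iS jS; rewrite -subr_eq0; have [z ->] := w6 i j iS jS.
  rewrite mulf_eq0 pnatr_eq0 /= intr_eq0 => z0; rewrite exprMn -natrX.
  rewrite (_ : (6 ^ 2)%:R = 36) // -[X in X <= _]mulr1 ler_wpM2l//.
  by rewrite -rmorphXn ler1z -gtz0_ge1 exprn_even_gt0.
have far_sum i (P : {pred I}) : i \in S ->
    {in P, forall j, j \in S /\ w i != w j} ->
    36 * #|P|%:R <= \sum_(j in S) (w i - w j) ^+ 2.
  move=> iS PS; apply: (@le_trans _ _ (\sum_(j in P) (w i - w j) ^+ 2)).
    rewrite mulr_natr -sumr_const; apply: ler_sum => j jP.
    by have [jS wij] := PS j jP; apply: far.
  rewrite [leRHS](bigID [in P]) /= [X in _ <= X + _](eq_bigl [in P]) => [|j].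
    by rewrite lerDl; apply: sumr_ge0 => j _; apply: sqr_ge0.
  by have [jP|] := boolP (j \in P); rewrite ?andbF ?andbT//; case: (PS j jP).
(* Each of the a b far pairs occurs in both orders. *)
have : 36 * (a * b)%:R *+ 2 <= \sum_(i in S) \sum_(j in S) (w i - w j) ^+ 2.
  rewrite (bigID [pred i | w i == w i0]) /= mulr2n lerD//.
    rewrite mulnC natrM mulrA mulr_natr -sumr_const.
    apply: ler_sum => i /andP[iS /eqP wi].
    apply: far_sum => // j; rewrite !inE => /andP[jS wj]; split=> //.
    by rewrite wi eq_sym.
  rewrite natrM mulrA mulr_natr -sumr_const; apply: ler_sum => i /andP[iS wi].
  apply: far_sum => // j; rewrite !inE => /andP[jS /eqP wj]; split=> //.
  by rewrite wj.
rewrite sum_sqr_diff lerMn2r /=; apply: le_trans; rewrite ler_wpM2l//.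
rewrite lerBlDr natr1 ler_nat Sab; case: (a) (b) a0 b0 => [|c] [|d] // _ _.
by rewrite mulSn mulnS; lia.
Qed.

Lemma block_value i0 : i0 \in S ->
    {in S, forall j, j != i0 -> w j = w i0 - 6} ->
  #|S|%:R * \sum_(j in S) w j ^+ 2 = 36 * (#|S|%:R - 1).
Proof.
move=> i0S wj; move: w_sum0; rewrite !(bigD1 i0 i0S) /=.
set n := #|[pred j in S | j != i0]|.
have -> : #|S|%:R = n.+1%:R :> R.
  rewrite (cardD1 i0) i0S; congr (_.+1%:R).
  by apply: eq_card => j; rewrite !inE andbC.
rewrite (eq_bigr (fun=> w i0 - 6)) => [|j /andP[]]; last exact: wj.
rewrite [in X in _ -> X](eq_bigr (fun=> (w i0 - 6) ^+ 2));
  last by move=> j /andP[jS ji]; rewrite wj.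
have sum_c c : \sum_(j in S | j != i0) c = n%:R * c :> R.
  by rewrite sumr_const mulr_natl.
rewrite !sum_c -natr1 => w0.
have nw : (n%:R + 1) * w i0 = 6 * n%:R by lra.
(* This form isolates the product (n + 1) w(i0), which the zero sum determines as 6 n. *)
transitivity ((n%:R + 1) * w i0 * w i0
    + n%:R * (w i0 - 6) * ((n%:R + 1) * w i0 - 6 * (n%:R + 1))); first by ring.
by rewrite nw; ring.
Qed.

End CenteredBlock.

(** * Projections along the Korkin-Zolotarev basis *)

Section KorkinZolotarev.
Variable R : realType.
Implicit Types (w y : 'rV[R]_12) (f : nat -> int).

(* For 0 < i, the first i vectors of the Korkin-Zolotarev basis are constant on
   block i.  Projecting them away annihilates the coordinates below the block and
   leaves those above it unchanged. *)
Definition block i : pred 'I_12 :=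
  [pred j : 'I_12 | (i.-1 <= j < if (i <= 4)%N then 4 else 12)%N].

Lemma block_pred i : (0 < i < 12)%N -> exists2 j, j \in block i & j = i.-1 :> nat.
Proof.
move=> i12; have p12 : (i.-1 < 12)%N by lia.
by exists (Ordinal p12) => //; rewrite inE /=; case: ifP; lia.
Qed.

Lemma mem_take_kz i y : (i <= 12)%N ->
  reflect (exists2 k, (k < i)%N & y = kz_vec R k) (y \in take i (kz R)).
Proof.
move=> i12; rewrite /kz /mkseq -map_take take_iota (minn_idPl i12).
apply: (iffP mapP) => -[k]; first by rewrite mem_iota => ki ->; exists k.
by move=> ki ->; exists k; rewrite ?mem_iota.
Qed.

Lemma dotp_six w (j : 'I_12) : dotp (six R j) w = 6 * w 0 j.
Proof.
rewrite /dotp (bigD1 j)//= big1 ?addr0 => [|k kj]; rewrite !mxE.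
  by rewrite eqxx (rmorph_nat _ 6).
by rewrite -val_eqE /= in kj; rewrite (negbTE kj) mul0r.
Qed.

Lemma dotp_tvec3 w : dotp (tvec R 3 3 0) w = 3 * \sum_(j < 12 | (j < 4)%N) w 0 j.
Proof.
rewrite /dotp mulr_sumr [RHS]big_mkcond; apply: eq_bigr => j _; rewrite !mxE.
case: triP => [j3|->|j4]; rewrite ?(rmorph_nat _ 3)//= ?mul0r;
  by case: ltnP => //; lia.
Qed.

Lemma dotp_tvec2 w : dotp (tvec R 0 2 2) w = 2 * \sum_(j < 12 | (3 <= j)%N) w 0 j.
Proof.
rewrite /dotp mulr_sumr [RHS]big_mkcond; apply: eq_bigr => j _; rewrite !mxE.
case: triP => [j3|->|j4]; rewrite ?(rmorph_nat _ 2)//= ?mul0r;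
  by case: ltnP => //; lia.
Qed.

Lemma kz_vec_block i k (j l : 'I_12) :
  (k < i)%N -> j \in block i -> l \in block i ->
  kz_vec R k 0 j = kz_vec R k 0 l.
Proof.
rewrite !inE /kz_vec => ki /= jb lb; case: eqP => [_|k0]; last case: eqP => [k4|k4].
- rewrite !mxE; congr intmul; move: jb lb.
  by case: ifP; case: (triP j); case: (triP l); lia.
- rewrite !mxE; congr intmul; move: jb lb.
  by case: ifP; case: (triP j); case: (triP l); lia.
- rewrite !mxE; have [-> ->] // :
    (j == k.-1 :> nat) = false /\ (l == k.-1 :> nat) = false.
  by split; apply/eqP; lia.
Qed.

Lemma kz_vec_tail i k (j : 'I_12) :
  (k < i <= 4)%N -> (4 <= j)%N -> kz_vec R k 0 j = 0.
Proof.
rewrite /kz_vec => ki j4; case: eqP => [_|k0]; last case: eqP => [k4|k4];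
  first 2 last.
- by rewrite mxE; case: eqP => //; lia.
- by rewrite mxE; case: triP => //; lia.
- by lia.
Qed.

Section Projection.
Variables (i : nat) (y : 'rV[R]_12).
Hypothesis i12 : (0 < i < 12)%N.
Local Notation U := <<take i (kz R)>>%VS.
Local Notation w := (perp_proj U y).

Lemma dotp_proj k : (k < i)%N -> dotp (kz_vec R k) w = 0.
Proof.
move=> ki; have [/mem_orthovP wU _] := perp_projP U y.
rewrite dotpC wU//; apply/memv_span/mem_take_kz; [lia|by exists k].
Qed.

(** Orthogonality to 6 e_j kills coordinate j for j <> 3. Coordinate 3 then vanishes by
    orthogonality to x, whose other nonzero entries meet killed coordinates. *)
Lemma proj_low (j : 'I_12) : (j < i.-1)%N -> w 0 j = 0.
Proof.
have low (k : 'I_12) : (k < i.-1)%N -> k != 3%N :> nat -> w 0 k = 0.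
  move=> ki k3; have := @dotp_proj k.+1;
  rewrite /kz_vec /= eqSS (negbTE k3) dotp_six.
  by move=> /(_ ltac:(lia)) /eqP; rewrite mulf_eq0 pnatr_eq0 => /eqP.
move=> ji; have [j3|] := eqVneq (j : nat) 3%N; last exact: low.
have := @dotp_proj 0; rewrite /kz_vec /= dotp_tvec3 => /(_ ltac:(lia)) /eqP.
rewrite mulf_eq0 pnatr_eq0 /= (bigD1 j) ?j3//=.
rewrite big1 ?addr0 => [/eqP //|k /andP[k4 kj]].
have k3 : k != 3%N :> nat.
  by apply: contraNneq kj => k3; apply/eqP/val_inj; rewrite /= k3.
by apply: low => //; lia.
Qed.

(** This is orthogonality to x when i <= 4 and to y when i > 4, the coordinates below the block
    being 0. *)
Lemma proj_sum0 : \sum_(j in block i) w 0 j = 0.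
Proof.
have [i4|i4] := leqP i 4.
  have := @dotp_proj 0; rewrite /kz_vec /= dotp_tvec3 => /(_ ltac:(lia)) /eqP.
  rewrite mulf_eq0 pnatr_eq0 /= => /eqP.
  rewrite (bigID (block i)) /= addrC big1 ?add0r.
    move=> s0; rewrite -[RHS]s0; apply: eq_bigl => j; rewrite inE /block /= i4; lia.
  by move=> j /andP[j4]; rewrite /block /= i4 => ji; apply: proj_low; lia.
have i4F : (i <= 4)%N = false by lia.
have := @dotp_proj 4; rewrite /kz_vec /= dotp_tvec2 => /(_ ltac:(lia)) /eqP.
rewrite mulf_eq0 pnatr_eq0 /= => /eqP.
rewrite (bigID (block i)) /= addrC big1 ?add0r.
  move=> s0; rewrite -[RHS]s0; apply: eq_bigl => j; rewrite inE /block /= i4F /=; lia.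
move=> j /andP[j4]; rewrite /block /= i4F /= => ji.
by apply: proj_low; have := ltn_ord j; lia.
Qed.

Lemma proj_diff : {in block i &, forall j k, w 0 j - w 0 k = y 0 j - y 0 k}.
Proof.
move=> j k jb kb; have [_ yU] := perp_projP U y.
have : (y - w) 0 j = (y - w) 0 k.
  apply: span_coord_eq yU => _ /mem_take_kz[|l li ->]; first by lia.
  exact: kz_vec_block jb kb.
by rewrite !mxE; lra.
Qed.

Lemma proj_tail (j : 'I_12) : (i <= 4)%N -> (4 <= j)%N -> w 0 j = y 0 j.
Proof.
move=> i4 j4; have [_ yU] := perp_projP U y.
have : (y - w) 0 j = 0.
  apply: span_coord_eq0 yU => _ /mem_take_kz[|l li ->]; first by lia.
  by apply: (@kz_vec_tail i); rewrite ?li.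
by rewrite !mxE => /eqP; rewrite subr_eq0 => /eqP.
Qed.

(** For i > 4 the block reaches the last coordinate and the second sum is empty. *)
Lemma dotp_projE : dotp w w = \sum_(j in block i) w 0 j ^+ 2
  + \sum_(j < 12 | (i <= 4 <= j)%N) y 0 j ^+ 2.
Proof.
rewrite /dotp [X in _ = X + _]big_mkcond [X in _ = _ + X]big_mkcond.
rewrite -big_split /=.
apply: eq_bigr => j _; rewrite -expr2.
have [ji|ji] := ltnP j i.-1.
  rewrite proj_low// inE /= [(i.-1 <= j)%N]leqNgt ji /= expr0n add0r.
  by case: ifP => //; lia.
rewrite inE /= ji /=; have [i4|i4] /= := leqP i 4; last by rewrite ltn_ord addr0.
by case: ltnP => j4; rewrite ?addr0 ?add0r// proj_tail.
Qed.

(** A centered constant block is 0; the whole projection would then vanish and [y] would lie in the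
    span. *)
Lemma proj_nonconstant : y \notin U ->
    (forall j : 'I_12, (i <= 4 <= j)%N -> y 0 j = 0) ->
  {in block i, forall j, exists2 k, k \in block i & w 0 k != w 0 j}.
Proof.
move=> yU y0 j jb; apply/exists_inP; apply: contraR yU => /exists_inPn wj.
suff w0 : w = 0 by have [_] := perp_projP U y; rewrite w0 subr0.
have wc k : k \in block i -> w 0 k = w 0 j by move=> /wj; rewrite negbK => /eqP.
have wj0 : w 0 j = 0.
  have := proj_sum0; rewrite (eq_bigr _ wc) sumr_const => /eqP.
  by rewrite mulrn_eq0 => /orP[/eqP/card0_eq/(_ j)|/eqP //]; rewrite jb.
apply/rowP => k; rewrite mxE; have [ki|ki] := ltnP k i.-1; first exact: proj_low.
have [kb|kb] := boolP (k \in block i); first by rewrite wc.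
move: kb; rewrite inE ki /=; have [i4|_] := leqP i 4; last by rewrite ltn_ord.
by rewrite -leqNgt => k4; rewrite proj_tail// y0// i4.
Qed.

End Projection.

(** High entries are all -2 [f 3] mod 6. If 3 divides [f 3], then 3 [f 3] and [f 3] agree mod 6, so
    the first four entries agree. *)
Lemma in_lat_diff f j k : in_lat f ->
    (4 <= j)%N && (4 <= k)%N || [&& (3 %| f 3%N)%Z, (j < 4)%N & (k < 4)%N] ->
  (6 %| f j - f k)%Z.
Proof.
move=> fL; have := fL j; have := fL k.
by case: (triP j) => [j3|->|j4]; case: (triP k) => [k3|->|k4]; lia.
Qed.

(** If 3 does not divide [f 3], the eight tail entries have size at least 2, giving 32. Otherwise
    they are multiples of 6, and a nonzero one gives 36. *)
Lemma tail_cases f : in_lat f ->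
  32 <= \sum_(j < 12 | (4 <= j)%N) f j ^+ 2 \/
  (3 %| f 3%N)%Z /\ forall j : 'I_12, (4 <= j)%N -> f j = 0.
Proof.
move=> fL; have [f3|f3] := boolP (3 %| f 3%N)%Z; last first.
  left; pose g j := if (4 <= j)%N then f j else 0.
  have -> : \sum_(j < 12 | (4 <= j)%N) f j ^+ 2 = sqn g.
    by rewrite big_mkcond; apply: eq_bigr => j _; rewrite /g; case: ifP.
  apply: (sqn_ge (a := 0) (b := 0) (c := 2)) => j /=.
  by have := fL j; rewrite /g; case: (triP j) => [j3|->|->]; lia.
have [/existsP[j /andP[j4 fj]]|/existsPn f0] :=
    boolP [exists j : 'I_12, (4 <= j)%N && (f j != 0)].
  left; rewrite (bigD1 j j4) /= -[32]addr0 lerD//.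
    apply: (@le_trans _ _ (6 ^+ 2)) => //; apply: ler_sqr_abs => //.
    by have := fL j; case: (triP j); lia.
  by apply: sumr_ge0 => k _; apply: sqr_ge0.
by right; split=> // j j4; have := f0 j; rewrite j4 negbK => /eqP.
Qed.

Lemma card_block_le4 i : (i <= 4)%N -> (#|block i| <= 4)%N.
Proof.
move=> i4; have card4 : #|[pred j : 'I_12 | (j < 4)%N]| = 4%N.
  by rewrite -sum1_card big_mkcond !big_ord_recl big_ord0.
apply: leq_trans (eq_leq card4); apply/subset_leq_card/fintype.subsetP => j.
by rewrite !inE /= i4 => /andP[].
Qed.

(** * Minimality of the projected basis vectors *)

Section Comparison.
Variable i : nat.
Hypothesis i12 : (0 < i < 12)%N.
Local Notation proj := (perp_proj <<take i (kz R)>>%VS).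
Local Notation m := (#|block i|%:R : R).

Lemma card_block_gt0 : 0 < m.
Proof.
by rewrite ltr0n; have [j jb _] := block_pred i12; apply/card_gt0P; exists j.
Qed.

Lemma block_sqr_ge0 y : 0 <= \sum_(j in block i) proj y 0 j ^+ 2.
Proof. by apply: sumr_ge0 => j _; apply: sqr_ge0. Qed.

Lemma tail_ivec f : \sum_(j < 12 | (i <= 4 <= j)%N) ivec R f 0 j ^+ 2
  = (\sum_(j < 12 | (i <= 4 <= j)%N) f j ^+ 2)%:~R.
Proof. by rewrite rmorph_sum; apply: eq_bigr => j _; rewrite mxE rmorphXn. Qed.

(** The last hypothesis removes the tail and makes block differences multiples of 6 when i <= 4; for
    i > 4 there is no tail and the differences are such multiples anyway. *)
Lemma proj_ge f : in_lat f -> ivec R f \notin <<take i (kz R)>>%VS ->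
    ((i <= 4)%N -> (3 %| f 3%N)%Z /\ forall j : 'I_12, (4 <= j)%N -> f j = 0) ->
  36 * (m - 1) <= m * dotp (proj (ivec R f)) (proj (ivec R f)).
Proof.
move=> fL yU f0; have [j0 j0b _] := block_pred i12.
have tail0 : \sum_(j < 12 | (i <= 4 <= j)%N) ivec R f 0 j ^+ 2 = 0.
  by rewrite tail_ivec big1// => j /andP[/f0[_ fj] /fj ->].
rewrite dotp_projE// tail0 addr0.
apply: (block_lower_bound _ _ _ j0b); first exact: proj_sum0.
  move=> j k jb kb; exists ((f j - f k) %/ 6)%Z.
  rewrite proj_diff// !mxE -rmorphB /=.
  rewrite -[6]/((6 : int)%:~R) -rmorphM /=; congr intmul.
  rewrite mulrC divzK//; apply: in_lat_diff => //; move: jb kb; rewrite !inE.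
  have [i4|i4] /= := leqP i 4 => /andP[ij j4] /andP[ik k4];
    last by apply/orP; left; lia.
  by have [f3 _] := f0 i4; rewrite f3 j4 k4 orbT.
apply: proj_nonconstant => // j /andP[/f0[_ fj] /fj].
by rewrite mxE => ->.
Qed.

Lemma proj_kz_vec : i != 4%N ->
  m * dotp (proj (kz_vec R i)) (proj (kz_vec R i)) = 36 * (m - 1).
Proof.
move=> i4; have uE : kz_vec R i = six R i.-1.
  by rewrite /kz_vec (negbTE i4); case: eqP => //; lia.
rewrite dotp_projE// [X in _ * (_ + X)]big1 ?addr0; last first.
  move=> j /andP[i4' j4].
  by rewrite uE mxE; case: eqP => [|_]; [lia|rewrite expr0n].
have [j0 j0b j0E] := block_pred i12.
apply: (block_value _ j0b); first exact: proj_sum0.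
move=> j jb /eqP jj0; have := proj_diff (kz_vec R i) i12 jb j0b.
rewrite uE !mxE -j0E eqxx; case: eqP => [/val_inj //|_].
by rewrite (rmorph_nat _ 6) /=; lra.
Qed.

End Comparison.

(** Block 4 is the single coordinate 3, which centering sends to 0; the eight entries 2 of y
    remain. *)
Lemma proj_kz_vec4 (U := <<take 4 (kz R)>>%VS) :
  dotp (perp_proj U (kz_vec R 4)) (perp_proj U (kz_vec R 4)) = 32.
Proof.
have b4 (j k : 'I_12) : j \in block 4 -> k \in block 4 -> j = k.
  by rewrite !inE /= => jb kb; apply/val_inj => /=; lia.
rewrite dotp_projE// big1 ?add0r.
  rewrite tail_ivec; rewrite (_ : \sum_(_ < _ | _) _ = 32) ?(rmorph_nat _ 32)//.
  by rewrite big_mkcond !big_ord_recl big_ord0.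
move=> j jb; have := proj_sum0 (i := 4) (kz_vec R 4) isT.
rewrite (bigD1 j jb) /= big1 ?addr0 => [->|k /andP[kb]]; first by rewrite expr0n.
by rewrite (b4 _ _ jb kb) eqxx.
Qed.

Lemma proj_kz_le i y (U := <<take i (kz R)>>%VS) : (0 < i < 12)%N ->
    lat y -> y \notin U ->
  dotp (perp_proj U (kz_vec R i)) (perp_proj U (kz_vec R i))
    <= dotp (perp_proj U y) (perp_proj U y).
Proof.
rewrite {}/U => i12 [f fL ->] yU.
have [iE|i4] := eqVneq i 4%N.
  subst i; rewrite proj_kz_vec4 dotp_projE// tail_ivec.
  have [tail32|[_ f0]] := tail_cases fL.
    by rewrite -[32]add0r lerD ?block_sqr_ge0// -[32]/((32 : int)%:~R) ler_int.
  have [j jb jE] := block_pred i12.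
  set w := perp_proj _ _.
  (* With zero tail, the projection would be nonconstant on a one-element block. *)
  have [k kb /eqP[]] : exists2 k, k \in block 4 & w 0 k != w 0 j.
    by apply: proj_nonconstant => // k /andP[_ /f0]; rewrite mxE => ->.
  congr (w 0 _); apply/val_inj => /=.
  by move: kb; rewrite inE /= jE /=; lia.
rewrite -(ler_pM2l (card_block_gt0 i12)) proj_kz_vec//.
have [i5|i5] := ltnP 4 i; first by apply: proj_ge => //; lia.
have [tail32|[f3 f0]] := tail_cases fL; last exact: proj_ge.
(* For m <= 4, 36 (m - 1) <= 32 m, so a tail of at least 32 suffices alone. *)
have m4 : #|block i|%:R <= 4 :> R by rewrite ler_nat card_block_le4.
apply: (@le_trans _ _ (#|block i|%:R * 32)); first by lra.
rewrite ler_wpM2l// dotp_projE// tail_ivec -[32]add0r lerD ?block_sqr_ge0//.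
by rewrite i5 -[32]/((32 : int)%:~R) ler_int.
Qed.


(** All these vectors have the minimal length 6, which settles the choice among minimizers; for i =
    0 the projection is the identity. *)
Lemma kz_korkin_zolotarev : korkin_zolotarev_basis lat (kz R).
Proof.
split=> [|i]; first exact: kz_basis.
rewrite size_mkseq => i12; rewrite nth_mkseq//.
have ki : kz_vec R i \in kz R by rewrite map_f// mem_iota.
have [Li _] := is_basis_mem (kz_basis R) ki.
have min6 y : lat y -> y \notin <<take i (kz R)>>%VS ->
    enorm (kz_vec R i) <= enorm y.
  move=> Ly yU; rewrite enorm_kz//; apply: lat_enorm_ge6 => //.
  by apply: contraNneq yU => ->; apply: mem0v.
split=> [|y [Ly yU _]]; last exact: min6.
split=> //.
  have [_ + _] := kz_basis R.
  rewrite -[X in free X](cat_take_drop i.+1) => /catl_free.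
  rewrite (take_nth 0) ?size_mkseq// nth_mkseq// -cats1.
  rewrite (perm_free (permEl (perm_catC _ _))).
  by rewrite free_cons => /andP[].
move=> y Ly yU; have [i0|i0] := posnP i.
  have proj0 (v : 'rV[R]_12) : perp_proj <<take i (kz R)>>%VS v = v.
    have [_] := perp_projP <<take i (kz R)>>%VS v.
    by rewrite i0 take0 span_nil memv0 subr_eq0 => /eqP.
  by rewrite !proj0; apply: min6.
by rewrite /enorm ler_wsqrtr// proj_kz_le// i0.
Qed.

End KorkinZolotarev.

Theorem theorem1p3 (R : realType) :
  exists (m n : nat) (L : set 'rV[R]_m) (v u : n.+1.-tuple 'rV[R]_m),
    [/\ is_lattice L /\ lattice_rank L n.+1,
        minkowski_basis L v,
        korkin_zolotarev_basis L u,
        enorm (tnth v ord_max) > max_enorm u &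
        is_primitive_minimum L n.+1 (max_enorm u)].
Proof.
exists 12%N, 11%N, lat, [tuple of mink R], [tuple of kz R].
split; [split| | | |].
- have [L0 LB] := lat_subgroup R; split=> //; exact: lat_isolated.
- by have [rk _ _] := kz_basis R; rewrite size_mkseq in rk.
- exact: mink_minkowski.
- exact: kz_korkin_zolotarev.
- rewrite (tnth_nth 0) max_enorm_kz.
  (* The last Minkowski vector is c, and the comparison becomes 36 < 60 under the root. *)
  rewrite -[nth _ _ _]/(tvec R 3 1 (-2)) enorm_tvec -sqrt36.
  by rewrite ltr_sqrt ?ltr_int ?ltr0z.
- exact: kz_primitive_minimum.
Qed.
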